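(* A Heyting semialgebra $(H,\sqsubset,0,1,\sqcap,\sqcup,\rightarrow)$ is a pre-Heyting algebra if and only if $\sqsubset$ is reflexive. Moreover, every reflexive Heyting semialgebra (i.e. one with $\sqsubset$ reflexive) is reflected in a Heyting algebra.
   Context: For a binary relation $\sqsubset$ on a set, let $a\preccurlyeq b$ mean: for all $c$, $c\sqsubset a$ implies $c\sqsubset b$, and $b\sqsubset c$ implies $a\sqsubset c$. Let $a\simeq b$ mean $a\preccurlyeq b$ and $b\preccurlyeq a$. A Heyting semialgebra $(H,\sqsubset,0,1,\sqcap,\sqcup,\rightarrow)$ is a set with a binary relation, constants $0,1$ and binary operations such that for all $a,b,c$: (H1) $\sqsubset$ is transitive; (H2) $(a\sqcap b)\sqcap c\simeq a\sqcap(b\sqcap c)$; (H3) $0\sqsubset a\sqsubset 1$; (H4) $c\sqsubset a\sqcap b$ iff $c\sqsubset a$ and $c\sqsubset b$; $a\preccurlyeq a\sqcap a$; $a\sqcap b\preccurlyeq a$ and $a\sqcap b\preccurlyeq b$; (H5) $a\sqcup b\sqsubset c$ iff $a\sqsubset c$ and $b\sqsubset c$; $a\preccurlyeq a\sqcup b$ and $b\preccurlyeq a\sqcup b$; $a\sqcup a\preccurlyeq a$; (H6) $a\sqcap b\sqsubset c$ iff $a\sqsubset (b\rightarrow c)$; if $a\sqsubset b$ then $c\preccurlyeq a\rightarrow(b\sqcap c)$; if $a\sqsubset b$ then $(b\rightarrow c)\sqcap a\preccurlyeq c$. A pre-Heyting algebra is a Heyting algebra except that the order need not be antisymmetric (i.e.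 $\sqsubset$ is a preorder with bottom $0$, top $1$, binary meets $\sqcap$, binary joins $\sqcup$ and relative pseudocomplement $\rightarrow$ in the order-theoretic sense). A homomorphism is a function $f$ with $f(0)=0$, $f(1)=1$, $a\sqsubset b\Rightarrow f(a)\sqsubset f(b)$, and commuting (with literal equality) with $\sqcap,\sqcup,\rightarrow$. $H$ is reflected in $H'$ if there is a homomorphism $f:H\to H'$ that is order-reflecting: $f(a)\sqsubset f(b)$ implies $a\sqsubset b$. (A Heyting algebra is regarded as a Heyting semialgebra via its order.) *)

(* Defs.v *)
From Stdlib Require Import Relations.Relation_Definitions.

Set Implicit Arguments.
Unset Strict Implicit.
Unset Printing Implicit Defensive.

Record hstruct : Type := HStruct {
  carrier :> Type;
  sq : carrier -> carrier -> Prop;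
  zero : carrier;
  one : carrier;
  meet : carrier -> carrier -> carrier;
  join : carrier -> carrier -> carrier;
  imp : carrier -> carrier -> carrier
}.

Arguments zero : clear implicits.
Arguments one : clear implicits.
Arguments sq : clear implicits.

Declare Scope hstruct_scope.
Delimit Scope hstruct_scope with H.
Bind Scope hstruct_scope with carrier.
Local Open Scope hstruct_scope.

Notation "a << b" := (sq _ a b) (at level 70, no associativity) : hstruct_scope.

Definition pre_le (T : Type) (R : relation T) (a b : T) : Prop :=
  forall c, (R c a -> R c b) /\ (R b c -> R a c).

Definition pre_eq (T : Type) (R : relation T) (a b : T) : Prop :=
  pre_le R a b /\ pre_le R b a.

Notation "a <~ b" := (pre_le (sq _) a b) (at level 70, no associativity)
  : hstruct_scope.
Notation "a =~ b" := (pre_eq (sq _) a b) (at level 70, no associativity)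
  : hstruct_scope.

Record heyting_semialgebra (H : hstruct) : Prop := HeytingSemialgebra {
  sq_trans : transitive H (sq H);
  meet_assoc : forall a b c : H,
    meet (meet a b) c =~ meet a (meet b c);
  zero_one : forall a : H, zero H << a /\ a << one H;
  meet_law : forall a b c : H,
    (c << meet a b <-> c << a /\ c << b) /\
    a <~ meet a a /\
    meet a b <~ a /\ meet a b <~ b;
  join_law : forall a b c : H,
    (join a b << c <-> a << c /\ b << c) /\
    a <~ join a b /\ b <~ join a b /\
    join a a <~ a;
  imp_law : forall a b c : H,
    (meet a b << c <-> a << imp b c) /\
    (a << b -> c <~ imp a (meet b c)) /\
    (a << b -> meet (imp b c) a <~ c)
}.

Section OrderNotions.
Variables (T : Type) (R : relation T).

Definition is_greatest (P : T -> Prop) (m : T) : Prop :=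
  P m /\ forall x, P x -> R x m.

Definition is_least (P : T -> Prop) (m : T) : Prop :=
  P m /\ forall x, P x -> R m x.

Definition is_meet (a b m : T) : Prop :=
  is_greatest (fun x => R x a /\ R x b) m.

Definition is_join (a b m : T) : Prop :=
  is_least (fun x => R a x /\ R b x) m.
End OrderNotions.

Record pre_heyting_algebra (H : hstruct) : Prop := PreHeytingAlgebra {
  pre_heyting_preorder : preorder H (sq H);
  pre_heyting_bottom : is_least (sq H) (fun _ => True) (zero H);
  pre_heyting_top : is_greatest (sq H) (fun _ => True) (one H);
  pre_heyting_meet : forall a b : H, is_meet (sq H) a b (meet a b);
  pre_heyting_join : forall a b : H, is_join (sq H) a b (join a b);
  pre_heyting_imp : forall a b : H,
    is_greatest (sq H) (fun x => meet a x << b) (imp a b)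
}.

Definition heyting_algebra (H : hstruct) : Prop :=
  pre_heyting_algebra H /\ antisymmetric H (sq H).

Record homomorphism (H H' : hstruct) (f : H -> H') : Prop := Homomorphism {
  hom_zero : f (zero H) = zero H';
  hom_one : f (one H) = one H';
  hom_sq : forall a b : H, a << b -> f a << f b;
  hom_meet : forall a b : H, f (meet a b) = meet (f a) (f b);
  hom_join : forall a b : H, f (join a b) = join (f a) (f b);
  hom_imp : forall a b : H, f (imp a b) = imp (f a) (f b)
}.

Definition order_reflecting (H H' : hstruct) (f : H -> H') : Prop :=
  forall a b : H, f a << f b -> a << b.

Definition reflected_in (H H' : hstruct) : Prop :=
  exists f : H -> H', homomorphism f /\ order_reflecting f.

(* The order of a Heyting algebra, with its own operations, makes it a Heyting
   semialgebra; hence [reflected_in] applies to it without any conversion. *)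
Lemma heyting_algebra_semialgebra (H : hstruct) :
  heyting_algebra H -> heyting_semialgebra H.
Proof.
intros [[[rf tr] [_ bo] [_ to] me jo im] _].
assert (m1 : forall a b : H, meet a b << a) by (intros a b; apply me).
assert (m2 : forall a b : H, meet a b << b) by (intros a b; apply me).
assert (mg : forall a b c : H, c << a -> c << b -> c << meet a b).
{ intros a b c h k. apply (proj2 (me a b)). split; assumption. }
assert (j1 : forall a b : H, a << join a b) by (intros a b; apply jo).
assert (j2 : forall a b : H, b << join a b) by (intros a b; apply jo).
assert (jl : forall a b c : H, a << c -> b << c -> join a b << c).
{ intros a b c h k. apply (proj2 (jo a b)). split; assumption. }
assert (le : forall a b : H, a << b -> a <~ b).
{ intros a b h c. split; intro k; eapply tr; eauto. }
assert (mp : forall a b : H, meet a (imp a b) << b) by (intros a b; apply im).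
assert (ig : forall a b c : H, meet a c << b -> c << imp a b).
{ intros a b c h. apply (proj2 (im a b)). exact h. }
split.
- exact tr.
- intros a b c. split; apply le; repeat apply mg; eauto.
- intro a. split; [apply bo | apply to]; exact I.
- intros a b c. split; [split | auto].
  + intro h. split; eapply tr; eauto.
  + intros [h k]; auto.
- intros a b c. split; [split | auto].
  + intro h. split; eapply tr; eauto.
  + intros [h k]; auto.
- intros a b c. split; [split | split].
  + intro h. apply ig. eapply tr; [|exact h]. auto.
  + intro h. eapply tr; [|apply (mp b c)]. apply mg; eauto.
  + intro h. apply le, ig, mg; eauto.
  + intro h. apply le. eapply tr; [|apply (mp b c)]. apply mg; eauto.
Qed.

(* Main.v *)
(** Reflexivity turns the laws stated with [<~] into laws for [<<], which makes
    a reflexive Heyting semialgebra pre-Heyting; conversely a preorder is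
    reflexive.  For the reflection, send [a] to the down-set of [a]: down-sets
    are equal exactly when their generators are equivalent, and the down-sets
    of [meet a b], [join a b] and [imp a b] can be described by those of [a]
    and [b] alone, so no representatives have to be chosen. *)

Require Import Defs.
From Stdlib Require Import Relations.Relation_Definitions.
From Stdlib Require Import FunctionalExtensionality PropExtensionality.
From Stdlib Require Import ProofIrrelevance.

Set Implicit Arguments.
Unset Strict Implicit.
Local Open Scope hstruct_scope.

Lemma reflexive_pre_le (T : Type) (R : relation T) (a b : T) :
  reflexive T R -> pre_le R a b -> R a b.
Proof. intros rf h. apply h, rf. Qed.

Lemma reflexive_pre_heyting (H : hstruct) :
  heyting_semialgebra H -> reflexive H (sq H) -> pre_heyting_algebra H.
Proof.
intros [tr _ zo ml jl il] rf.
(* In [imp_law] the antecedent is the right factor of the meet, in [pre_heyting_imp] the left one;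
   swapping the factors bridges the two conventions. *)
assert (comm : forall a b : H, meet a b << meet b a).
{ intros a b. apply (ml b a). destruct (ml a b a) as (_ & _ & h1 & h2).
  split; apply reflexive_pre_le; assumption. }
split.
- split; assumption.
- split; [exact I | intros x _; apply zo].
- split; [exact I | intros x _; apply zo].
- intros a b. split.
  + exact (proj1 (proj1 (ml a b (meet a b))) (rf _)).
  + intros x hx. exact (proj2 (proj1 (ml a b x)) hx).
- intros a b. split.
  + exact (proj1 (proj1 (jl a b (join a b))) (rf _)).
  + intros x hx. exact (proj2 (proj1 (jl a b x)) hx).
- intros a b. split.
  + apply (tr _ (meet (imp a b) a)); [apply comm|].
    exact (proj2 (proj1 (il (imp a b) a b)) (rf _)).
  + intros x hx. apply (proj1 (il x a b)), (tr _ (meet a x)); [apply comm | exact hx].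
Qed.

(** Every element of [H'] is an image, and [f] preserves and reflects the order, so each law in [H']
    can be pulled back to [H], proved there, and pushed forward. This spares a direct verification
    of the laws for down-sets. *)
Lemma surjective_reflection_pre_heyting (H H' : hstruct) (f : H -> H') :
  pre_heyting_algebra H -> homomorphism f -> order_reflecting f ->
  (forall y, exists x, y = f x) -> pre_heyting_algebra H'.
Proof.
intros [[rf tr] [_ bo] [_ to] me jo im] [f0 f1 fs fm fj fi] fr surj.
split.
- split.
  + intro y. destruct (surj y) as [a ->]. apply fs, rf.
  + intros x y z. destruct (surj x) as [a ->], (surj y) as [b ->],
      (surj z) as [c ->].
    intros h k. apply fs, (tr _ b); apply fr; assumption.
- split; [exact I|]. intros y _. destruct (surj y) as [a ->].
  rewrite <- f0. apply fs, bo, I.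
- split; [exact I|]. intros y _. destruct (surj y) as [a ->].
  rewrite <- f1. apply fs, to, I.
- intros x y. destruct (surj x) as [a ->], (surj y) as [b ->].
  rewrite <- fm. split.
  + split; apply fs, me.
  + intros z [h k]. destruct (surj z) as [c ->].
    apply fs, me. split; apply fr; assumption.
- intros x y. destruct (surj x) as [a ->], (surj y) as [b ->].
  rewrite <- fj. split.
  + split; apply fs, jo.
  + intros z [h k]. destruct (surj z) as [c ->].
    apply fs, jo. split; apply fr; assumption.
- intros x y. destruct (surj x) as [a ->], (surj y) as [b ->].
  rewrite <- fi. split.
  + rewrite <- fm. apply fs, im.
  + intros z h. destruct (surj z) as [c ->].
    rewrite <- fm in h. apply fs, im, fr, h.
Qed.

Section DownSets.
Variables (H : hstruct) (hH : pre_heyting_algebra H).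

Definition generates (a : H) (P : H -> Prop) : Prop :=
  forall x, P x <-> x << a.

Definition downset : Type := {P : H -> Prop | exists a, generates a P}.

Definition below (P Q : H -> Prop) : Prop := forall x, P x -> Q x.

Definition inter (P Q : H -> Prop) (x : H) : Prop := P x /\ Q x.

(** A union of two principal down-sets need not be principal; this is its Dedekind-MacNeille
    closure, the lower bounds of its upper bounds. *)
Definition hull (P Q : H -> Prop) (x : H) : Prop :=
  forall c, below P (fun y => y << c) -> below Q (fun y => y << c) -> x << c.

(** The Kripke clause for implication. *)
Definition residual (P Q : H -> Prop) (x : H) : Prop :=
  forall y, y << x -> P y -> Q y.

Lemma generates_inter (a b : H) (P Q : H -> Prop) :
  generates a P -> generates b Q -> generates (meet a b) (inter P Q).
Proof using hH.
destruct hH as [[rf tr] _ _ me _ _]. intros hP hQ x.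
unfold inter. rewrite (hP x), (hQ x). destruct (me a b) as [[ha hb] hg].
split; [apply hg | intro h; split; eapply tr; eauto].
Qed.

Lemma generates_hull (a b : H) (P Q : H -> Prop) :
  generates a P -> generates b Q -> generates (join a b) (hull P Q).
Proof using hH.
destruct hH as [[rf tr] _ _ _ jo _]. intros hP hQ x.
destruct (jo a b) as [[ha hb] hl]. split.
(* The element [join a b] is itself a common upper bound of [P] and [Q], so it may serve as the [c]
   of [hull]. *)
- intro h. apply h; intros y hy.
  + apply (tr _ a); [apply hP, hy | exact ha].
  + apply (tr _ b); [apply hQ, hy | exact hb].
- intros h c ka kb. apply (tr _ (join a b)); [exact h | apply hl; split].
  + apply ka, hP, rf.
  + apply kb, hQ, rf.
Qed.

Lemma generates_residual (a b : H) (P Q : H -> Prop) :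
  generates a P -> generates b Q -> generates (imp a b) (residual P Q).
Proof using hH.
destruct hH as [[rf tr] _ _ me _ im]. intros hP hQ x.
destruct (im a b) as [hb hg]. split.
(* The test element is [meet a x]: it lies below [x] and in [P], hence in [Q], that is, below
   [b]. *)
- intro h. apply hg. destruct (me a x) as [[ka kx] _].
  apply hQ, h; [exact kx | apply hP, ka].
- intros h y hy ky. apply hQ. apply (tr _ (meet a (imp a b))); [|exact hb].
  apply me. split; [apply hP, ky | apply (tr _ x); assumption].
Qed.

Lemma generates_down (a : H) : generates a (fun x => x << a).
Proof using. intro x. reflexivity. Qed.

Definition down (a : H) : downset :=
  exist _ (fun x => x << a) (ex_intro _ a (@generates_down a)).

(** Generators are only known to exist in [Prop]. They are unpacked solely in the proof component,
    where this elimination is allowed. *)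
Definition lift (op : H -> H -> H) (Op : (H -> Prop) -> (H -> Prop) -> H -> Prop)
    (hop : forall a b P Q,
      generates a P -> generates b Q -> generates (op a b) (Op P Q))
    (X Y : downset) : downset :=
  exist _ (Op (proj1_sig X) (proj1_sig Y))
    (match proj2_sig X, proj2_sig Y with
     | ex_intro _ a ha, ex_intro _ b hb => ex_intro _ (op a b) (hop a b _ _ ha hb)
     end).

Definition downset_algebra : hstruct :=
  @HStruct downset (fun X Y => below (proj1_sig X) (proj1_sig Y))
    (down (zero H)) (down (one H))
    (lift generates_inter) (lift generates_hull) (lift generates_residual).

Lemma downset_ext (X Y : downset) :
  (forall x, proj1_sig X x <-> proj1_sig Y x) -> X = Y.
Proof using.
destruct X as [P hP], Y as [Q hQ]. intro h. apply subset_eq_compat.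
apply functional_extensionality. intro x. apply propositional_extensionality, h.
Qed.

Lemma down_of_generates (a : H) (X : downset) :
  generates a (proj1_sig X) -> down a = X.
Proof using.
intro h. apply downset_ext. intro x. symmetry. apply h.
Qed.

Lemma down_surjective (X : downset) : exists a, X = down a.
Proof using.
destruct (proj2_sig X) as [a ha]. exists a. symmetry.
apply down_of_generates, ha.
Qed.

(** The operations commute with [down] up to literal equality because a down-set is determined by
    any of its generators. *)
Lemma down_homomorphism : @homomorphism H downset_algebra down.
Proof.
split.
- reflexivity.
- reflexivity.
- intros a b h x k. destruct hH as [[_ tr] _ _ _ _ _]. apply (tr _ a); assumption.
- intros a b. apply down_of_generates, generates_inter; apply generates_down.
- intros a b. apply down_of_generates, generates_hull; apply generates_down.
- intros a b. apply down_of_generates, generates_residual; apply generates_down.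
Qed.

Lemma down_order_reflecting : @order_reflecting H downset_algebra down.
Proof.
intros a b h. destruct hH as [[rf _] _ _ _ _ _]. apply h, rf.
Qed.

Lemma downset_heyting_algebra : heyting_algebra downset_algebra.
Proof.
split.
- exact (surjective_reflection_pre_heyting hH down_homomorphism
    down_order_reflecting down_surjective).
- intros X Y h k. apply downset_ext. intro x. split; [apply h | apply k].
Qed.

End DownSets.

Theorem proposition10 (H : hstruct) (hH : heyting_semialgebra H) :
  (pre_heyting_algebra H <-> reflexive H (sq H)) /\
  (reflexive H (sq H) ->
   exists H' : hstruct, heyting_algebra H' /\ reflected_in H H').
Proof.
split.
- split.
  + intros [[rf _] _ _ _ _ _]. exact rf.
  + apply reflexive_pre_heyting, hH.
- intro rf. pose proof (reflexive_pre_heyting hH rf) as pH.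
  exists (downset_algebra pH). split; [apply downset_heyting_algebra|].
  exists (@down H). split;
    [apply down_homomorphism | apply down_order_reflecting].
Qed.
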